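(* For any regular estimator $E$, and for all $r,\alpha\ge0$, $$\underline\Delta(E;r,\alpha)\ \ge\ \Delta_{\mathrm{wc}}(r,\alpha).$$
   Context: Setting. $\Xi=\Theta=\mathbb R$; $\mathcal P$ is the set of Borel probability distributions on $\mathbb R$ with the weak topology. $g:\mathbb R\to(0,\infty)$ is a log-concave probability density, symmetric around the origin, and for $\theta\in\mathbb R$, $\mathbb P_\theta$ is the distribution with density $\xi\mapsto g(\xi-\theta)$. Divergences. $\mathrm{KL}(\mathbb P,\mathbb Q)=\int\log\frac{d\mathbb P}{d\mathbb Q}\,d\mathbb P$ if $\mathbb P\ll\mathbb Q$ and $+\infty$ otherwise; $\mathrm{TV}(\mathbb P,\mathbb Q)=\inf\{\epsilon>0:\mathbb Q(A)\le\mathbb P(A)+\epsilon,\ \mathbb P(A)\le\mathbb Q(A)+\epsilon\ \forall \text{ measurable }A\}$. DRO set and worst-case radius. $S_{r,\alpha}(\hat{\mathbb P})=\{\theta\in\Theta:\exists\,\mathbb Q\in\mathcal P,\ \mathrm{KL}(\hat{\mathbb P},\mathbb Q)\le r,\ \mathrm{TV}(\mathbb Q,\mathbb P_\theta)\le\alpha\}$. For nonempty $U\subseteq\mathbb R$, the Chebyshev radius is $\mathrm{radius}(U)=\inf_{s\in\mathbb R}\sup_{s'\in U}|s-s'|$ (half the diameter, possibly $+\infty$), and $\mathrm{radius}(\emptyset)=0$. $\Delta_{\mathrm{wc}}(r,\alpha)=\sup_{\hat{\mathbb P}\in\mathcal P}\mathrm{radius}(S_{r,\alpha}(\hat{\mathbb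 P}))$. Estimators. An estimator is a function $E:\mathcal P\to\Theta$; it is regular if it is continuous for the weak topology. For $\mathbb P^{c}\in\mathcal P$, $\mathbb P_n$ is the empirical distribution of $n$ i.i.d. samples from $\mathbb P^{c}$. The pair $(E,\Delta)$, $\Delta\ge0$, satisfies the coverage guarantee at $(r,\alpha)$ if for all $\theta^\star\in\Theta$ and all $\mathbb P^{c}\in\mathcal P$ with $\mathrm{TV}(\mathbb P^{c},\mathbb P_{\theta^\star})\le\alpha$: - if $r>0$: $\limsup_{n\to\infty}\frac1n\log\mathrm{Prob}_{\mathbb P^{c}}(|E(\mathbb P_n)-\theta^\star|>\Delta)<-r$; - if $r=0$: $\limsup_{n\to\infty}\mathrm{Prob}_{\mathbb P^{c}}(|E(\mathbb P_n)-\theta^\star|>\Delta)=0$. $\underline\Delta(E;r,\alpha)=\inf\{\Delta\ge0:(E,\Delta)\text{ satisfies the coverage guarantee at }(r,\alpha)\}$, with $\inf\emptyset=+\infty$. *)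

(* Defs.v *)
From HB Require Import structures.
From mathcomp Require Import all_boot all_order all_algebra.
From mathcomp Require Import interval_inference.
From mathcomp Require Import all_classical all_reals all_analysis.
From mathcomp Require Import measurable_realfun.

Set Implicit Arguments.
Unset Strict Implicit.
Unset Printing Implicit Defensive.

Import Order.TTheory GRing.Theory Num.Theory.
Import numFieldNormedType.Exports.

Local Open Scope classical_set_scope.
Local Open Scope ring_scope.

(** Borel probability distributions on the line, with the weak topology: the
    coarsest one making [P |-> \int f dP] continuous for every bounded
    continuous [f]. Two elements may differ on non-measurable sets, but the
    topology, the divergences and the sampling laws below do not see this. *)
Definition distr (R : realType) : Type := probability (measurableTypeR R) R.

Definition bounded_continuous (R : realType) : Type :=
  {f : R -> R | continuous f /\ exists M, forall x, `|f x| <= M}.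

Section weak_topology.
Variable R : realType.

HB.instance Definition _ := gen_eqMixin (distr R).
HB.instance Definition _ := gen_choiceMixin (distr R).

Definition expect (f : bounded_continuous R) (P : distr R) : R :=
  \int[P]_x (projT1 f) x.

HB.instance Definition _ := Topological.copy (distr R)
  (sup_topology (fun f => Topological.on (initial_topology (expect f)))).

End weak_topology.

Section divergences.
Context {R : realType}.
Local Open Scope ereal_scope.

(* [lne 0 = -oo], and [P] does not charge the set where ['d P '/d Q <= 0] *)
Definition KL (P Q : distr R) : \bar R :=
  if `[< P `<< Q >]
  then \int[P]_x lne (Radon_Nikodym (charge_of_finite_measure P) Q x)
  else +oo.

Definition TV (P Q : distr R) : \bar R :=
  ereal_inf [set e%:E | e in [set e : R | (0 < e)%R /\
    forall A : set (measurableTypeR R), measurable A ->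
      Q A <= P A + e%:E /\ P A <= Q A + e%:E]].

End divergences.

Record symmetric_logconcave_density (R : realType) := SymLogConcave {
  density :> R -> R ;
  density_gt0 : forall x, 0 < density x ;
  measurable_density : measurable_fun [set: R] density ;
  integral_density : (\int[lebesgue_measure]_x (density x)%:E = 1)%E ;
  density_logconcave : convex_function [set: R^o] (fun x => - ln (density x)) ;
  density_even : forall x, density (- x) = density x }.

Section location_family.
Context {R : realType}.
Variables (g : symmetric_logconcave_density R) (theta : R).
Local Notation mu := (@lebesgue_measure R).
Local Open Scope ereal_scope.

Definition location_prob (A : set (measurableTypeR R)) : \bar R :=
  \int[mu]_(x in A) (g (x - theta))%:E.

Let shift : measurableTypeR R -> measurableTypeR R := fun x => (x - theta)%R.

Let mshift : measurable_fun [set: measurableTypeR R] shift.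
Proof. exact: measurable_funB. Qed.

Let lebesgue_shift A : measurable A -> mu A = pushforward mu shift A.
Proof.
apply: lebesgue_measure_unique => _ [[a b]] _ <-.
have shiftE : shift @^-1` `]a, b] = `](a + theta)%R, (b + theta)%R]%classic.
  by apply/seteqP; split => x /=; rewrite /shift !in_itv/= ltrBrDr lerBlDr.
transitivity (mu (shift @^-1` `]a, b])); last by [].
rewrite shiftE !lebesgue_measure_itv/= !lte_fin ltrD2r -!EFinB.
by rewrite opprD addrACA subrr addr0.
Qed.

Let measurable_shifted : measurable_fun [set: R] (fun x => g (x - theta)%R).
Proof.
apply: (@measurableT_comp _ _ _ _ _ _ g); first exact: measurable_density.
exact: measurable_funB.
Qed.

Let integral_shifted : \int[mu]_x (g (x - theta))%:E = 1.
Proof.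
rewrite -(integral_density g).
transitivity (\int[pushforward mu shift]_x (g x)%:E).
  rewrite ge0_integral_pushforward//=.
    by apply/measurable_EFinP; exact: measurable_density.
  by move=> x _; rewrite lee_fin ltW// density_gt0.
apply: eq_measure_integral => A mA _; exact: (esym (lebesgue_shift mA)).
Qed.

Let location0 : location_prob set0 = 0.
Proof. exact: integral_set0. Qed.

Let location_ge0 A : 0 <= location_prob A.
Proof. by apply: integral_ge0 => x _; rewrite lee_fin ltW// density_gt0. Qed.

Let location_sigma_additive : semi_sigma_additive location_prob.
Proof.
move=> /= F mF tF mUF; rewrite /location_prob ge0_integral_bigcup//=.
- apply: is_cvg_ereal_nneg_natsum_cond => n _ _; exact: location_ge0.
- by apply/measurable_EFinP; exact: measurable_funTS.
- by move=> x _; rewrite lee_fin ltW// density_gt0.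
Qed.

HB.instance Definition _ := isMeasure.Build _ _ _
  location_prob location0 location_ge0 location_sigma_additive.

Let location_setT : location_prob setT = 1.
Proof. exact: integral_shifted. Qed.

HB.instance Definition _ :=
  @Measure_isProbability.Build _ _ R location_prob location_setT.

End location_family.

Section worst_case_radius.
Context {R : realType}.
Local Open Scope ereal_scope.

Definition dro_set (g : symmetric_logconcave_density R) (r alpha : R)
    (Phat : distr R) : set R :=
  [set theta | exists Q : distr R,
     KL Phat Q <= r%:E /\ TV Q (location_prob g theta) <= alpha%:E].

Definition chebyshev_radius (U : set R) : \bar R :=
  if U == set0 then 0
  else ereal_inf [set ereal_sup [set `|s - s'|%:E | s' in U] | s in [set: R]].

Definition Delta_wc (g : symmetric_logconcave_density R) (r alpha : R) :
    \bar R :=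
  ereal_sup [set chebyshev_radius (dro_set g r alpha Phat) |
             Phat in [set: distr R]].

End worst_case_radius.

Section sampling.
Local Open Scope ereal_scope.

Section cons_pair.
Context d (T : measurableType d) (n : nat).

Definition cons_pair (x : T * n.-tuple T) : n.+1.-tuple T :=
  [tuple of x.1 :: x.2].

Let measurable_cons_pair : measurable_fun setT cons_pair.
Proof. exact: measurable_cons. Qed.

HB.instance Definition _ :=
  @isMeasurableFun.Build _ _ _ _ cons_pair measurable_cons_pair.

End cons_pair.

(* the law of [n] i.i.d. samples from [P], i.e. the [n]-fold product of [P] *)
Fixpoint iid {R : realType} d (T : measurableType d)
    (P : probability T R) n : probability (n.-tuple T) R :=
  match n with
  | 0 => \d_([tuple] : 0.-tuple T)
  | m.+1 => distribution (P \x iid P m) (@cons_pair _ T m)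
  end.

Section empirical.
Context {R : realType} (n : nat) (x : n.+1.-tuple (measurableTypeR R)).

Definition empirical (A : set (measurableTypeR R)) : \bar R :=
  (n.+1%:R^-1)%:E * \sum_(i < n.+1) \d_(tnth x i) A.

Let empirical0 : empirical set0 = 0.
Proof. by rewrite /empirical big1 ?mule0// => i _; rewrite measure0. Qed.

Let empirical_ge0 A : 0 <= empirical A.
Proof. by rewrite mule_ge0// ?lee_fin// sume_ge0. Qed.

Let empirical_sigma_additive : semi_sigma_additive empirical.
Proof.
have -> : empirical =
    mscale (n.+1%:R^-1)%:nng%R (msum (fun i => \d_(tnth x (inord i))) n.+1).
  apply/funext => A; congr (_ * _).
  by apply: eq_bigr => i _; rewrite inord_val.
exact: measure_semi_sigma_additive.
Qed.

HB.instance Definition _ := isMeasure.Build _ _ _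
  empirical empirical0 empirical_ge0 empirical_sigma_additive.

Let empirical_setT : empirical setT = 1.
Proof.
rewrite /empirical; under eq_bigr do rewrite diracT.
by rewrite sumEFin sumr_const card_ord -EFinM mulVf.
Qed.

HB.instance Definition _ :=
  Measure_isProbability.Build _ _ _ empirical empirical_setT.

End empirical.

End sampling.

Section estimation.
Context {R : realType}.
Variables (g : symmetric_logconcave_density R) (E : distr R -> R).
Local Open Scope ereal_scope.

(* [P_n] only makes sense for [0 < n]; hence sequences below are indexed by [n]
   and concern [n.+1] samples, which does not affect limits superior. The event
   is measurable (indeed open) when [E] is continuous. *)
Definition error_prob (Pc : distr R) (theta Delta : R) (n : nat) : \bar R :=
  iid Pc n.+1 [set x | (Delta < `|E (empirical x) - theta|)%R].

Definition coverage (r alpha Delta : R) : Prop :=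
  forall (theta : R) (Pc : distr R),
    TV Pc (location_prob g theta) <= alpha%:E ->
    ((0 < r)%R ->
      limn_esup (fun n => (n.+1%:R^-1)%:E * lne (error_prob Pc theta Delta n))
        < (- r)%:E) /\
    (r = 0%R -> limn_esup (error_prob Pc theta Delta) = 0).

Definition Delta_inf (r alpha : R) : \bar R :=
  ereal_inf [set Delta%:E | Delta in
    [set Delta : R | (0 <= Delta)%R /\ coverage r alpha Delta]].

End estimation.

(* Main.v *)
Require Import Defs.
From HB Require Import structures.
From mathcomp Require Import all_boot all_order all_algebra.
From mathcomp Require Import all_classical all_reals all_analysis.
From mathcomp Require Import measurable_realfun ring lra.
Import Order.TTheory GRing.Theory Num.Theory.
Import numFieldNormedType.Exports.
Local Open Scope classical_set_scope.
Local Open Scope ring_scope.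
Set Implicit Arguments.
Unset Strict Implicit.
Unset Printing Implicit Defensive.

(** Fix a centre [P] of the divergence ball. The point [E P] serves as a
    Chebyshev centre: if [(E, Delta)] satisfies the coverage guarantee, then
    every [theta] of the set attached to [P] lies within [Delta] of [E P], so
    the radius of that set is at most [Delta].

    Indeed, let [Q] witness that [theta] belongs to the set, so [KL P Q <= r]
    and [Q] is an admissible data-generating law for the parameter [theta].
    Suppose [|E P - theta| > Delta]. As [E] is weakly continuous, the laws on
    which [E] errs by more than [Delta] form a weak neighbourhood of [P].
    Samples from [P] have their empirical law in it with probability tending
    to 1 ([typical_cvg]), so the error probability under [P] tends to 1. The
    lower bound of Sanov's theorem then says that under [Q] the error
    probability decays no faster than [exp (- n r)], and does not vanish at all
    when [r = 0]: this contradicts coverage under [Q].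

    The lower bound is obtained without densities of product measures. The
    bound [KL P Q <= K] is used only through its dual (Gibbs, or
    Donsker-Varadhan) form
      [int (ln F) dP <= K + ln (int F dQ)]
    for positive bounded [F] away from 0 ([log_integral_bound]). In this form
    it passes to [n]-fold products, with [n * K] in place of [K], by a plain
    induction with Fubini's theorem ([iid_log_integral_bound]). The choice
    [F = exp (t * 1_A)] yields
      [t * P^n(A) <= n * K + ln (1 + (exp t - 1) * Q^n(A))],
    and if [Q^n(A) <= exp (- n c)] with [c > r], then [t = n c] gives
    [c * P^n(A) <= r + ln 2 / n], which is absurd when [P^n(A)] tends to 1
    ([error_prob_decay_ge]).

    Convergence of empirical laws is phrased with a filter: a set of laws is
    typical if the empirical law avoids it with vanishing probability. Weak
    convergence of this filter to [P] need only be tested on one bounded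
    continuous function at a time, which is Chebyshev's inequality. *)

(** * Bounded measurable functions and product laws *)

Lemma measurable_superlevel d (T : measurableType d) (R : realType)
    (f : T -> R) (c : R) : measurable_fun [set: T] f ->
  measurable [set x | c <= f x] /\ measurable [set x | c < f x].
Proof.
move=> mf; have mfS (b : bool) :
    measurable (f @^-1` [set` Interval (BSide b c) +oo%O]).
  by rewrite -[X in measurable X]setTI; exact: mf.
by split; [have := mfS true|have := mfS false]; congr measurable;
  apply/seteqP; split=> x /=; rewrite in_itv/= andbT.
Qed.

Definition bounded_measurable d (T : measurableType d) (R : realType)
    (f : T -> R) : Prop :=
  measurable_fun [set: T] f /\ exists M, forall x, `|f x| <= M.

Section bounded_measurable.
Context d (T : measurableType d) (R : realType).
Implicit Types (f g : T -> R) (P : probability T R).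

Lemma bounded_measurable_cst c : bounded_measurable (fun _ : T => c : R).
Proof. by split; [exact: measurable_cst|exists `|c|]. Qed.

Lemma bounded_measurableD f g : bounded_measurable f -> bounded_measurable g ->
  bounded_measurable (fun x => f x + g x).
Proof.
move=> [mf [M fM]] [mg [N gN]]; split; first exact: measurable_funD.
by exists (M + N) => x; rewrite (le_trans (ler_normD _ _))// lerD.
Qed.

Lemma bounded_measurableM f g : bounded_measurable f -> bounded_measurable g ->
  bounded_measurable (fun x => f x * g x).
Proof.
move=> [mf [M fM]] [mg [N gN]]; split; first exact: measurable_funM.
by exists (M * N) => x; rewrite normrM ler_pM.
Qed.

Lemma bounded_measurable_itv f a b : measurable_fun [set: T] f ->
  (forall x, a <= f x <= b) -> bounded_measurable f.
Proof.
move=> mf fab; split=> //; exists (`|a| + `|b|) => x.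
have /andP[fa fb] := fab x; rewrite ler_norml; apply/andP; split.
- rewrite (le_trans _ fa)// lerNl.
  by rewrite (le_trans (ler_norm _))// normrN lerDl.
- by rewrite (le_trans fb)// (le_trans (ler_norm _))// lerDr.
Qed.

Lemma bounded_measurable_ln f a b : 0 < a -> measurable_fun [set: T] f ->
  (forall x, a <= f x <= b) -> bounded_measurable (fun x => ln (f x)).
Proof.
move=> a0 mf fab; apply: (@bounded_measurable_itv _ (ln a) (ln b)).
  by apply: measurableT_comp => //; exact: measurable_ln.
move=> x; have /andP[fa fb] := fab x.
have fx0 : 0 < f x by exact: lt_le_trans fa.
by rewrite !ler_ln ?posrE ?fa ?fb// (lt_le_trans fx0).
Qed.

Lemma bounded_measurable_indic A : measurable A ->
  bounded_measurable (\1_A : T -> R).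
Proof.
move=> mA; apply: (bounded_measurable_itv (a := 0) (b := 1)).
  exact: measurable_indic.
by move=> x; rewrite indicE; case: (_ \in _); rewrite ler01 lexx.
Qed.

Lemma bounded_measurable_integrable P f : bounded_measurable f ->
  P.-integrable setT (EFin \o f).
Proof.
move=> [mf [M fM]]; apply: measurable_bounded_integrable => //.
  exact: (le_lt_trans (probability_le1 P measurableT) (ltry _)).
by exists M; split; [exact: num_real|move=> N MN x _; exact: (le_trans (fM x) (ltW MN))].
Qed.

Lemma Rintegral_probability_cst P (c : R) : \int[P]_x c = c.
Proof.
rewrite Rintegral_cst// -[RHS]mulr1; congr (_ * _).
exact: (congr1 fine (probability_setT P)).
Qed.

Lemma Rintegral_itv P f a b : measurable_fun [set: T] f ->
  (forall x, a <= f x <= b) -> a <= \int[P]_x f x <= b.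
Proof.
move=> mf fab; have fi := bounded_measurable_integrable P (bounded_measurable_itv mf fab).
have ci c := bounded_measurable_integrable P (bounded_measurable_cst c).
apply/andP; split; [rewrite -[leLHS](Rintegral_probability_cst P)|
                    rewrite -[leRHS](Rintegral_probability_cst P)];
  by apply: le_Rintegral => // x _; have /andP[] := fab x.
Qed.

Lemma Rintegral_indic P A : measurable A -> \int[P]_x \1_A x = fine (P A).
Proof. by move=> mA; rewrite /Rintegral integral_indic// setIT. Qed.

End bounded_measurable.

Section iid_fubini.
Context d (T : measurableType d) (R : realType) (P : probability T R) (n : nat).
Variable F : n.+1.-tuple T -> R.
Hypothesis bF : bounded_measurable F.

Let bFc : bounded_measurable (F \o @cons_pair _ T n).
Proof.
case: bF => mF [M FM]; split; last by exists M => x; exact: FM.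
exact: measurableT_comp.
Qed.

Let Fc_integrable :
  (P \x iid P n)%E.-integrable setT (EFin \o (F \o @cons_pair _ T n)).
Proof. exact: bounded_measurable_integrable. Qed.

Lemma bounded_measurable_section x :
  bounded_measurable (fun y : n.-tuple T => F [tuple of x :: y]).
Proof.
case: bF => mF [M FM]; split; last by exists M => y; exact: FM.
by apply: (measurableT_comp mF); exact: measurable_cons.
Qed.

Let fubini_fin x : fubini_F (iid P n) (EFin \o (F \o @cons_pair _ T n)) x =
  (\int[iid P n]_y F [tuple of x :: y])%:E.
Proof.
rewrite /fubini_F fineK//; apply: integrable_fin_num => //.
exact: (bounded_measurable_integrable _ (bounded_measurable_section x)).
Qed.

Lemma bounded_measurable_partial_integral :
  bounded_measurable (fun x => \int[iid P n]_y F [tuple of x :: y]).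
Proof.
have [M FM] := bF.2.
apply: (@bounded_measurable_itv _ _ _ _ (- M) M).
  apply/measurable_EFinP.
  apply: (eq_measurable_fun _ _ (measurable_fubini_F Fc_integrable)) => x _.
  exact: fubini_fin.
move=> x; apply: Rintegral_itv; first by have [] := bounded_measurable_section x.
by move=> y; rewrite -ler_norml.
Qed.

Lemma iid_fubini : \int[iid P n.+1]_z F z =
  \int[P]_x \int[iid P n]_y F [tuple of x :: y].
Proof.
rewrite /Rintegral/= integral_distribution//=; last first.
  by apply/measurable_EFinP; have [] := bF.
rewrite -(integral12_prod_meas1 Fc_integrable); congr fine.
by apply: eq_integral => x _; rewrite fubini_fin.
Qed.

End iid_fubini.

(** * The dual form of relative entropy bounds *)

(** Neither function need be integrable: positive and negative parts are
    compared separately, and the convention [+oo - +oo = -oo] keeps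
    subtraction monotone. *)
Lemma ae_le_integral d (T : measurableType d) (R : realType)
    (mu : {measure set T -> \bar R}) (f g : T -> \bar R) :
  measurable_fun [set: T] f -> measurable_fun [set: T] g ->
  {ae mu, forall x, (f x <= g x)%E} ->
  (\int[mu]_x f x <= \int[mu]_x g x)%E.
Proof.
move=> mf mg fg; rewrite integralE [leRHS]integralE; apply: leeB.
- apply: ae_ge0_le_integral => //; [exact: measurable_funepos..|].
  by apply: filterS fg => x fgx _; rewrite !funeposE ge_max !le_max lexx fgx orbT.
- apply: ae_ge0_le_integral => //; [exact: measurable_funeneg..|].
  apply: filterS fg => x fgx _.
  by rewrite !funenegE ge_max !le_max lexx leeN2 fgx orbT.
Qed.

Lemma ln_leB1 (R : realType) (x : R) : 0 < x -> ln x <= x - 1.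
Proof.
by move=> x0; have := @le_ln1Dx R (x - 1); rewrite subrKC; apply; lra.
Qed.

(** By Gibbs' variational principle this is equivalent to [KL P Q <= K] for
    laws on the line, but it is meaningful, and easy to tensorize, without
    mentioning densities. The bounds on [F] make both sides finite. *)
Definition log_integral_bound d (T : measurableType d) (R : realType)
    (P Q : probability T R) (K : R) : Prop :=
  forall (F : T -> R) (a b : R), 0 < a -> measurable_fun [set: T] F ->
    (forall x, a <= F x <= b) ->
    \int[P]_x ln (F x) <= K + ln (\int[Q]_x F x).

Section relative_entropy.
Context d (T : measurableType d) (R : realType) (P Q : probability T R).
Hypothesis PQ : P `<< Q.
Local Notation rho := (Radon_Nikodym_SigmaFinite.f P Q).
Local Notation dPdQ := (Radon_Nikodym (charge_of_finite_measure P) Q).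

Let mrho : measurable_fun [set: T] rho.
Proof. exact: measurable_int (Radon_Nikodym_SigmaFinite.f_integrable PQ). Qed.

Let frho x : rho x \is a fin_num.
Proof. exact: Radon_Nikodym_SigmaFinite.f_fin_num. Qed.

Let mfrho : measurable_fun [set: T] (fine \o rho).
Proof. exact: measurableT_comp. Qed.

Let density_pos : {ae P, forall x, dPdQ x = rho x /\ (0 < rho x)%E}.
Proof.
have eq_rho : {ae P, forall x, dPdQ x = rho x}.
  have := null_dominates_ae_eq measurableT PQ
    (ae_eq_Radon_Nikodym_SigmaFinite PQ measurableT).
  by apply: filterS => x /(_ I).
have rho_gt0 : {ae P, forall x, (0 < rho x)%E}.
  have mN : measurable [set x | (rho x <= 0)%E].
    by rewrite -[X in measurable X]setTI; exact: emeasurable_fun_infty_c.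
  exists [set x | (rho x <= 0)%E]; split => //.
    apply/eqP; rewrite eq_le measure_ge0 andbT.
    rewrite (Radon_Nikodym_SigmaFinite.f_integral PQ mN).
    rewrite integral0_eq// => x /= rho_le0; apply/eqP.
    by rewrite eq_le rho_le0 Radon_Nikodym_SigmaFinite.f_ge0.
  by move=> x /= /negP; rewrite -leNgt.
by apply: filterS2 eq_rho rho_gt0.
Qed.

Let measurable_lne_density : measurable_fun [set: T] (fun x => lne (dPdQ x)).
Proof.
have fd x : dPdQ x \is a fin_num by exact: Radon_Nikodym_fin_num.
have mfd : measurable_fun [set: T] (fine \o dPdQ) by exact: measurableT_comp.
rewrite (_ : (fun x => _) = fun x =>
    if 0 < fine (dPdQ x) then (ln (fine (dPdQ x)))%:E else -oo%E).
  apply: measurable_fun_ifT => //.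
    exact: measurable_fun_ltr.
  by apply/measurable_EFinP; apply: measurableT_comp => //; exact: measurable_ln.
by apply/funext => x; rewrite -(fineK (fd x))/= ltNge if_neg.
Qed.

(** With [rho = dP/dQ] and [c = int F dQ], integrate against [P] the
    inequality [ln u <= u - 1] at [u = F / (rho c)]. The right-hand side
    integrates to at most 0 because [int (F / rho) dP <= int F dQ]. The
    integrable minorant [B] of [ln rho] obtained in this way avoids any
    discussion of the integrability of [ln rho]. *)
Lemma relative_entropy_log_integral_bound (K : R) :
  (\int[P]_x lne (dPdQ x) <= K%:E)%E -> log_integral_bound P Q K.
Proof.
move=> KLK F a b a0 mF Fab; set c := \int[Q]_x F x.
have F0 x : 0 < F x by have /andP[/(lt_le_trans a0)] := Fab x.
have c0 : 0 < c by have /andP[/(lt_le_trans a0)] := Rintegral_itv Q mF Fab.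
(* where the density vanishes, [k] is 0 as the inverse of 0 is 0 *)
pose k x := F x / fine (rho x).
have frho_ge0 x : 0 <= fine (rho x).
  by rewrite fine_ge0// Radon_Nikodym_SigmaFinite.f_ge0.
have k0 x : 0 <= k x by rewrite divr_ge0// ltW.
have mk : measurable_fun [set: T] k.
  apply: measurable_funM => //.
  rewrite (_ : (fun x => _) = (fun y => y `^ (-1)) \o (fine \o rho)).
    by apply: measurableT_comp => //; exact: measurable_powR.
  by apply/funext => x /=; rewrite powR_inv1.
have kc : (\int[P]_x (k x)%:E <= c%:E)%E.
  rewrite -(Radon_Nikodym_SigmaFinite.change_of_variables PQ)//; last first.
    exact/measurable_EFinP.
  rewrite /c /Rintegral fineK; last first.
    apply: integrable_fin_num => //.
    exact: bounded_measurable_integrable (bounded_measurable_itv mF Fab).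
  apply: ge0_le_integral => //.
  - by move=> x _; rewrite mule_ge0// ?lee_fin// Radon_Nikodym_SigmaFinite.f_ge0.
  - by apply: emeasurable_funM => //; exact/measurable_EFinP.
  - exact/measurable_EFinP.
  - move=> x _; rewrite -(fineK (frho x)) -EFinM lee_fin /k.
    have [->|r0] := eqVneq (fine (rho x)) 0; first by rewrite mulr0 ltW.
    by rewrite divfK.
have ki : P.-integrable setT (EFin \o k).
  apply/integrableP; split; first exact/measurable_EFinP.
  rewrite (le_lt_trans _ (ltry c))// (le_trans _ kc)// le_eqVlt; apply/orP; left.
  by apply/eqP/eq_integral => x _ /=; rewrite ger0_norm.
have lnFi : P.-integrable setT (EFin \o (fun x => ln (F x))).
  exact: bounded_measurable_integrable (bounded_measurable_ln a0 mF Fab).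
have ci (r : R) : P.-integrable setT (EFin \o (fun _ => r)).
  exact: bounded_measurable_integrable (bounded_measurable_cst _ r).
(* [B <= ln rho] rearranges the inequality above *)
pose B x := (ln (F x) + (1 - ln c)) - c^-1 * k x.
have i1 : P.-integrable setT (EFin \o (fun x => ln (F x) + (1 - ln c))).
  exact: (integrableD measurableT lnFi (ci _)).
have i2 : P.-integrable setT (EFin \o (fun x => c^-1 * k x)).
  exact: (integrableZl measurableT c^-1 ki).
have Bi : P.-integrable setT (EFin \o B).
  exact: (integrableB measurableT i1 i2).
have BK : \int[P]_x B x <= K.
  rewrite -lee_fin /Rintegral fineK; last exact: integrable_fin_num.
  apply: le_trans KLK; apply: ae_le_integral => //.
    by have /integrableP[] := Bi.
  apply: filterS density_pos => x [-> rho0].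
  have r0 : 0 < fine (rho x) by rewrite -lte_fin fineK.
  rewrite -(fineK (frho x)) lne_EFin// lee_fin /B.
  have := ln_leB1 (divr_gt0 (divr_gt0 (F0 x) r0) c0).
  rewrite ln_div ?posrE ?divr_gt0// ln_div ?posrE// [c^-1 * _]mulrC /k.
  by move=> ?; lra.
have kc' : c^-1 * \int[P]_x k x <= 1.
  rewrite mulrC ler_pdivrMr// mul1r -lee_fin /Rintegral fineK//.
  exact: integrable_fin_num.
move: BK; rewrite RintegralB// RintegralD// RintegralZl//.
by rewrite Rintegral_probability_cst => ?; lra.
Qed.

End relative_entropy.

(** Chain rule in dual form: for a function [F] of [n + 1] observations, the
    inductive hypothesis bounds the inner integral of [ln F] over the last [n]
    ones by [n K + ln G], where [G] is the integral of [F] over them, and the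
    one-dimensional bound applies to [G]. *)
Lemma iid_log_integral_bound d (T : measurableType d) (R : realType)
    (P Q : probability T R) (K : R) (n : nat) : log_integral_bound P Q K ->
  log_integral_bound (iid P n) (iid Q n) (n%:R * K).
Proof.
move=> PQK; elim: n => [|n ih] F a b a0 mF Fab.
  have FE y : F y = F [tuple] by rewrite (tuple0 y).
  under eq_Rintegral do rewrite FE.
  under [X in _ <= _ + ln X]eq_Rintegral do rewrite FE.
  by rewrite !Rintegral_probability_cst mul0r add0r.
have bF := bounded_measurable_itv mF Fab.
have blnF := bounded_measurable_ln a0 mF Fab.
have msection x : measurable_fun [set: n.-tuple T] (fun y => F [tuple of x :: y]).
  by have [] := bounded_measurable_section bF x.
have [mG _] := bounded_measurable_partial_integral Q bF.
have Gab x : a <= \int[iid Q n]_y F [tuple of x :: y] <= b.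
  by apply: Rintegral_itv => // y; exact: Fab.
rewrite !iid_fubini//.
have blnG := bounded_measurable_ln a0 mG Gab.
have bcst := bounded_measurable_cst T (n%:R * K).
apply: (@le_trans _ _ (\int[P]_x (n%:R * K +
    ln (\int[iid Q n]_y F [tuple of x :: y])))).
  apply: le_Rintegral => //.
  - exact: bounded_measurable_integrable (bounded_measurable_partial_integral P blnF).
  - exact: bounded_measurable_integrable (bounded_measurableD bcst blnG).
  - by move=> x _; apply: (ih _ a b) => // y; exact: Fab.
rewrite RintegralD//; [|exact: bounded_measurable_integrable..].
rewrite Rintegral_probability_cst.
have := PQK _ _ _ a0 mG Gab.
by rewrite -natr1 mulrDl mul1r -addrA lerD2l.
Qed.

(** The dual bound at [F = exp (t * 1_A)]: an event that is likely under [P]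
    cannot be too unlikely under [Q]. The parameter [t] is left free, to be
    matched with the decay rate of [Q A]. *)
Lemma log_integral_bound_event d (T : measurableType d) (R : realType)
    (P Q : probability T R) (K t : R) (A : set T) :
  log_integral_bound P Q K -> 0 <= t -> measurable A ->
  t * fine (P A) <= K + ln (1 + (expR t - 1) * fine (Q A)).
Proof.
move=> PQK t0 mA.
have et1 : 1 <= expR t by rewrite -expR0 ler_expR.
pose F x : R := 1 + (expR t - 1) * \1_A x.
have bI := bounded_measurable_indic R mA.
have bcst (c : R) := bounded_measurable_cst T c.
have mF : measurable_fun [set: T] F.
  by have [] := bounded_measurableD (bcst 1) (bounded_measurableM (bcst (expR t - 1)) bI).
have Fb x : 1 <= F x <= expR t.
  rewrite /F indicE; case: (_ \in _).
    by rewrite mulr1 subrKC et1 lexx.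
  by rewrite mulr0 addr0 lexx.
have := PQK F 1 (expR t) ltr01 mF Fb.
have lnF x : ln (F x) = t * \1_A x.
  rewrite /F indicE; case: (_ \in _); first by rewrite !mulr1 subrKC expRK.
  by rewrite !mulr0 addr0 ln1.
under eq_Rintegral do rewrite lnF.
rewrite RintegralZl//; last exact: bounded_measurable_integrable.
rewrite RintegralD//; last 2 first.
- exact: bounded_measurable_integrable.
- exact: bounded_measurable_integrable (bounded_measurableM (bcst (expR t - 1)) bI).
rewrite RintegralZl//; last exact: bounded_measurable_integrable.
by rewrite Rintegral_probability_cst !Rintegral_indic.
Qed.

(** * Deviations of sample means *)

Section sample_sum.
Context d (T : measurableType d) (R : realType) (P : probability T R).
Variables (h : T -> R) (M : R).
Hypotheses (mh : measurable_fun [set: T] h) (hM : forall x, `|h x| <= M).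
Hypothesis h_centered : \int[P]_x h x = 0.

Let S n (x : n.-tuple T) : R := \sum_(i < n) h (tnth x i).

Let bh : bounded_measurable h. Proof. by split=> //; exists M. Qed.

Let bS n : bounded_measurable (@S n).
Proof.
split; first by apply: measurable_sum => i; apply: measurableT_comp => //;
  exact: measurable_tnth.
exists (n%:R * M) => x; rewrite (le_trans (ler_norm_sum _ _ _))//.
rewrite (le_trans (ler_sum _ (fun i _ => hM (tnth x i))))//.
by rewrite sumr_const card_ord mulr_natl.
Qed.

Let S_cons n x (y : n.-tuple T) : S [tuple of x :: y] = h x + S y.
Proof.
by rewrite /S big_ord_recl; congr (_ + _); apply: eq_bigr => i _; rewrite tnthS.
Qed.

Let integral_S n : \int[iid P n]_x S x = 0.
Proof.
elim: n => [|n ih].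
  under eq_Rintegral do rewrite /S big_ord0.
  exact: Rintegral_probability_cst.
rewrite iid_fubini//.
under eq_Rintegral => x _.
  under eq_Rintegral do rewrite S_cons.
  rewrite RintegralD//; last 2 first.
    exact: bounded_measurable_integrable (bounded_measurable_cst _ (h x)).
    exact: bounded_measurable_integrable (bS n).
  rewrite Rintegral_probability_cst ih addr0.
  over.
exact: h_centered.
Qed.

(** The cross term in [(h x + S y) ^+ 2] integrates to 0 as [S] is centred. *)
Lemma iid_variance_le n :
  \int[iid P n]_x (\sum_(i < n) h (tnth x i)) ^+ 2 <= n%:R * M ^+ 2.
Proof.
have bi d' (T' : measurableType d') (Q : probability T' R) (f : T' -> R) :
    bounded_measurable f -> Q.-integrable setT (EFin \o f).
  exact: bounded_measurable_integrable.
have bS2 m : bounded_measurable (fun x : m.-tuple T => S x ^+ 2).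
  by have := bounded_measurableM (bS m) (bS m).
elim: n => [|n ih].
  under eq_Rintegral do rewrite big_ord0.
  by rewrite Rintegral_probability_cst expr0n mul0r.
rewrite (iid_fubini _ (bS2 n.+1)).
have E x : \int[iid P n]_y S [tuple of x :: y] ^+ 2 =
    h x ^+ 2 + \int[iid P n]_y S y ^+ 2.
  under eq_Rintegral do rewrite S_cons sqrrD.
  have bc (c : R) := bounded_measurable_cst (n.-tuple T) c.
  have b2 : bounded_measurable (fun y : n.-tuple T => h x * S y *+ 2).
    have -> : (fun y => h x * S y *+ 2) = (fun y : n.-tuple T => (h x *+ 2) * S y).
      by apply/funext => y; rewrite mulrnAl.
    exact: bounded_measurableM (bc _) (bS n).
  rewrite RintegralD//; last 2 first.
  - exact: bi (bounded_measurableD (bc (h x ^+ 2)) b2).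
  - exact: bi (bS2 n).
  rewrite RintegralD//; last 2 first.
  - exact: bi (bc (h x ^+ 2)).
  - exact: bi b2.
  rewrite Rintegral_probability_cst.
  under [X in _ + X + _]eq_Rintegral do rewrite -mulrnAl.
  by rewrite RintegralZl//; [rewrite integral_S mulr0 addr0|exact: bi (bS n)].
under eq_Rintegral do rewrite E.
have bh2 : bounded_measurable (fun x => h x ^+ 2).
  by have := bounded_measurableM bh bh.
rewrite RintegralD//; last 2 first.
- exact: bi.
- exact: bi (bounded_measurable_cst _ _).
rewrite Rintegral_probability_cst -natr1 mulrDl mul1r addrC lerD//.
have h2 x : 0 <= h x ^+ 2 <= M ^+ 2.
  by rewrite sqr_ge0/= -[leLHS]real_normK ?num_real// lerXn2r ?nnegrE// (le_trans _ (hM x)).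
by have /andP[] := Rintegral_itv P bh2.1 h2.
Qed.

Lemma measurable_deviation n (e : R) :
  measurable [set x : n.+1.-tuple T |
    e <= `|n.+1%:R^-1 * \sum_(i < n.+1) h (tnth x i)|].
Proof.
apply: (measurable_superlevel _ _).1; apply: measurableT_comp => //.
exact: measurable_funM (measurable_cst _) (bS n.+1).1.
Qed.

Lemma iid_chebyshev n (e : R) : 0 < e ->
  (iid P n.+1 [set x | (e <= `|n.+1%:R^-1 * \sum_(i < n.+1) h (tnth x i)|)%R]
   <= (M ^+ 2 / (n.+1%:R * e ^+ 2))%R%:E)%E.
Proof.
move=> e0; set N := [set x | _].
have n0 : 0 < n.+1%:R :> R by rewrite ltr0n.
have mN : measurable N by exact: measurable_deviation.
rewrite -(fineK (fin_num_measure (iid P n.+1) N mN)) lee_fin -Rintegral_indic//.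
have b1 := bounded_measurable_indic R mN.
have bS2 : bounded_measurable (fun x : n.+1.-tuple T => S x ^+ 2).
  by have := bounded_measurableM (bS n.+1) (bS n.+1).
rewrite ler_pdivlMr ?mulr_gt0 ?exprn_gt0//.
rewrite -(ler_pM2l n0) (le_trans _ (iid_variance_le n.+1))//.
rewrite mulrC -mulrA.
rewrite -RintegralZr//; last exact: bounded_measurable_integrable.
apply: le_Rintegral => //.
- exact: bounded_measurable_integrable (bounded_measurableM b1 (bounded_measurable_cst _ _)).
- exact: bounded_measurable_integrable bS2.
move=> x _; rewrite indicE; case: (boolP (x \in N)) => [/set_mem|_]; last first.
  by rewrite mul0r sqr_ge0.
rewrite /N/= mul1r normrM normrV ?unitfE ?gt_eqF// gtr0_norm// mulrC ler_pdivlMr//.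
move=> eS; rewrite -[leRHS]real_normK ?num_real//.
have -> (m : R) : m * e ^+ 2 * m = (e * m) ^+ 2 by ring.
by rewrite lerXn2r ?nnegrE// ltW// mulr_gt0.
Qed.

End sample_sum.

(** * Empirical laws in the weak topology *)

(** A subbase of the weak topology is tested one function at a time, and a
    filter is closed under finite intersections. *)
Lemma weak_cvg (R : realType) (F : set_system (distr R)) (P : distr R) :
  Filter F -> (forall f : bounded_continuous R, expect f @ F --> expect f P) ->
  F --> P.
Proof.
move=> FF cvgF; apply/cvg_sup => f A /= [_ [[B oB <-] BP] BA].
by apply: filterS BA _; apply: (cvgF f); exact: open_nbhs_nbhs.
Qed.

Lemma bounded_continuous_measurable (R : realType) (f : bounded_continuous R) :
  bounded_measurable (projT1 f : measurableTypeR R -> R).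
Proof.
by case: f => f [cf bf]; split=> //; exact: continuous_measurable_fun.
Qed.

Section empirical_expectation.
Context {R : realType} (n : nat) (x : n.+1.-tuple (measurableTypeR R)).

Let integral_empirical_ge0 (g : measurableTypeR R -> R) :
  measurable_fun setT g -> (forall y, 0 <= g y) ->
  \int[empirical x]_y g y = n.+1%:R^-1 * \sum_(i < n.+1) g (tnth x i).
Proof.
move=> mg g0; rewrite /Rintegral.
have mEg : measurable_fun setT (EFin \o g) by exact/measurable_EFinP.
rewrite (eq_measure_integral (mscale (n.+1%:R^-1)%:nng%R
    (msum (fun i => \d_(tnth x (inord i))) n.+1))); last first.
  move=> A mA _; congr (_ * _)%E.
  by apply: eq_bigr => i _; rewrite inord_val.
rewrite ge0_integral_mscale//; last by move=> y _; rewrite lee_fin.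
rewrite ge0_integral_measure_sum//; last by move=> y _; rewrite lee_fin.
under eq_bigr => i _.
  rewrite integral_dirac// inord_val diracT mul1e.
  over.
by rewrite sumEFin.
Qed.

(** Adding a constant reduces a bounded function to a nonnegative one. *)
Lemma integral_empirical (f : measurableTypeR R -> R) : bounded_measurable f ->
  \int[empirical x]_y f y = n.+1%:R^-1 * \sum_(i < n.+1) f (tnth x i).
Proof.
move=> bf; have [mf [M fM]] := bf.
have bM := bounded_measurable_cst (measurableTypeR R) M.
have bfM := bounded_measurableD bf bM.
have fM0 y : 0 <= f y + M by rewrite -lerBlDr sub0r; have /ler_normlP[]:= fM y; rewrite lerNl.
have := integral_empirical_ge0 bfM.1 fM0.
rewrite RintegralD//; [|exact: bounded_measurable_integrable..].
rewrite Rintegral_probability_cst big_split/= sumr_const card_ord mulrDr.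
by rewrite -[M *+ _]mulr_natl mulKf ?pnatr_eq0// => /addIr.
Qed.

Lemma expect_empirical (f : bounded_continuous R) :
  expect f (empirical x) = n.+1%:R^-1 * \sum_(i < n.+1) projT1 f (tnth x i).
Proof. exact/integral_empirical/bounded_continuous_measurable. Qed.

End empirical_expectation.

Section typical_sets.
Context {R : realType} (P : distr R).

(** The event that the empirical law avoids [U] is only required to be covered
    by a measurable event of small probability: it need not be measurable for
    a general [U], and outer covers make the filter axioms immediate. *)
Definition rarely_avoids (U : set (distr R)) (e : R) (n : nat) : Prop :=
  exists N : set (n.+1.-tuple (measurableTypeR R)),
    [/\ measurable N, (forall x, ~ U (empirical x) -> N x) &
        (iid P n.+1 N <= e%:E)%E].

Definition typical : set_system (distr R) :=
  [set U | forall e : R, 0 < e -> \forall n \near \oo, rarely_avoids U e n].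

Lemma typical_filter : Filter typical.
Proof.
split.
- move=> e e0; apply: nearW => n; exists set0; split=> [//|x /(_ I)//|].
  by rewrite measure0 lee_fin ltW.
- move=> U V tU tV e e0; have e20 : 0 < e / 2 by rewrite divr_gt0.
  apply: filterS2 (tU _ e20) (tV _ e20) => n [N [mN UN PN]] [N' [mN' VN' PN']].
  exists (N `|` N'); split; first exact: measurableU.
    by move=> x /not_andP[/UN|/VN']; [left|right].
  rewrite (le_trans (measureU2 _ _ _))// (le_trans (leeD PN PN'))//.
  by rewrite -EFinD -splitr.
- move=> U V UV tU e e0; apply: filterS (tU _ e0) => n [N [mN UN PN]].
  by exists N; split => // x nVx; apply: UN => /UV.
Qed.

(** The weak law of large numbers for empirical laws. *)
Lemma typical_cvg : typical --> P.
Proof.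
have tF := typical_filter; apply: weak_cvg => f.
apply/cvgrPdist_lt => eps eps0.
set m := expect f P.
pose h y := projT1 f y - m.
have bf := bounded_continuous_measurable f.
have bh : bounded_measurable (h : measurableTypeR R -> R).
  exact: bounded_measurableD bf (bounded_measurable_cst _ (- m)).
have [mh [M' hM']] := bh.
have h0 : \int[P]_y h y = 0.
  rewrite RintegralB//; [|exact: bounded_measurable_integrable|
    exact: bounded_measurable_integrable (bounded_measurable_cst _ m)].
  by rewrite Rintegral_probability_cst subrr.
move=> e e0.
near=> n.
have n0 : 0 < n.+1%:R :> R by rewrite ltr0n.
exists [set x : n.+1.-tuple (measurableTypeR R) |
  eps <= `|n.+1%:R^-1 * \sum_(i < n.+1) h (tnth x i)|].
have cheb := iid_chebyshev mh hM' h0 n eps0.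
split.
- exact: measurable_deviation.
- move=> x /= /negP; rewrite -leNgt expect_empirical distrC.
  by rewrite sumrB sumr_const card_ord mulrBr -[m *+ _]mulr_natl mulKf ?pnatr_eq0.
- rewrite (le_trans cheb)// lee_fin.
  rewrite ler_pdivrMr ?mulr_gt0 ?exprn_gt0// mulrCA.
  rewrite -ler_pdivrMr ?mulr_gt0 ?exprn_gt0// (@le_trans _ _ n%:R) ?ler_nat//.
  by near: n; exact: nbhs_infty_ger.
Unshelve. all: by end_near. Qed.

End typical_sets.

(** * Measurability of the error event *)

Definition grid (R : realType) (k : nat) (z : int) : R := z%:~R / k.+1%:R.

Definition grid_index (R : realType) (k : nat) (r : R) : int :=
  Num.floor (r * k.+1%:R).

Lemma cvg_grid (R : realType) (r : R) : grid R k (grid_index k r) @[k --> \oo] --> r.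
Proof.
apply/cvgrPdist_lt => e e0; near=> k.
have k0 : 0 < k.+1%:R :> R by rewrite ltr0n.
have ke : k.+1%:R^-1 < e by near: k; exact: near_infty_natSinv_lt (PosNum e0).
rewrite /grid /grid_index; have /andP[] := floor_itv (r * k.+1%:R).
set z := Num.floor _; rewrite intrD -ler_pdivrMr// -ltr_pdivlMr// mulrDl mul1r.
move=> zr rz; rewrite ger0_norm ?subr_ge0// ltrBlDl.
by rewrite (lt_trans rz)// ltrD2l.
Unshelve. all: by end_near. Qed.

Lemma measurable_grid_index (R : realType) k z :
  measurable [set r : measurableTypeR R | grid_index k r = z].
Proof.
have k0 : 0 < k.+1%:R :> R by rewrite ltr0n.
rewrite (_ : mkset _ = `[z%:~R / k.+1%:R, (z + 1)%:~R / k.+1%:R[%classic).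
  exact: measurable_itv.
apply/seteqP; split=> r; rewrite /= in_itv/= ler_pdivrMr// ltr_pdivlMr//.
  by move=> /eqP; rewrite floor_eq.
by rewrite -floor_eq => /eqP.
Qed.

(** [h] is the pointwise limit of its composites with the rounding of all
    coordinates to the grid of mesh [1 / (k + 1)]. Rounding takes countably
    many values, each on a box, so these composites are measurable whatever
    [h] is. *)
Lemma seq_continuous_measurable (R : realType) (n : nat)
    (h : n.-tuple (measurableTypeR R) -> R) :
  (forall (u : nat -> n.-tuple (measurableTypeR R)) x,
     (forall i, tnth (u k) i @[k --> \oo] --> tnth x i) ->
     h (u k) @[k --> \oo] --> h x) ->
  measurable_fun [set: n.-tuple (measurableTypeR R)] h.
Proof.
move=> ch.
pose pt k (z : n.-tuple int) : n.-tuple (measurableTypeR R) :=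
  [tuple grid R k (tnth z i) | i < n].
pose idx k (x : n.-tuple (measurableTypeR R)) : n.-tuple int :=
  [tuple grid_index k (tnth x i) | i < n].
apply: (@measurable_fun_cvg _ _ _ _ (fun k x => h (pt k (idx k x)))); last first.
  move=> x _; apply: ch => i.
  under eq_fun do rewrite !tnth_mktuple.
  exact: cvg_grid.
move=> k _ Y mY; rewrite setTI.
pose box z := [set x | idx k x = z].
have mbox z : measurable (box z).
  rewrite (_ : box z = \bigcap_(i in [set: 'I_n])
      (fun x => tnth x i) @^-1` [set r | grid_index k r = tnth z i]).
    apply: fin_bigcap_measurable => // i _; rewrite -[X in measurable X]setTI.
    by apply: measurable_tnth => //; exact: measurable_grid_index.
  apply/seteqP; split=> x /=.
    by move=> <- i _; rewrite /= tnth_mktuple.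
  by move=> xz; apply/eq_from_tnth => i; rewrite tnth_mktuple; exact: xz.
rewrite (_ : _ @^-1` Y = \bigcup_m [set x | exists2 z, unpickle m = Some z &
    Y (h (pt k z)) /\ box z x]).
  apply: bigcupT_measurable => m.
  case E : (unpickle m) => [z|]; last first.
    rewrite (_ : mkset _ = set0)//.
    by apply/seteqP; split=> x //= -[].
  have [Yz|nYz] := pselect (Y (h (pt k z))).
    rewrite (_ : mkset _ = box z)//.
    by apply/seteqP; split=> x /=; [case=> z' [<-] []|exists z].
  rewrite (_ : mkset _ = set0)//.
  by apply/seteqP; split=> x //= -[z' [<-] []].
apply/seteqP; split=> x /=.
  by move=> Yx; exists (pickle (idx k x)) => //=; exists (idx k x); rewrite ?pickleK.
by move=> [m _ [z _ [Yz xz]]]; rewrite -xz in Yz.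
Qed.

Lemma empirical_cvg (R : realType) n (u : nat -> n.+1.-tuple (measurableTypeR R))
    (x : n.+1.-tuple (measurableTypeR R)) :
  (forall i, tnth (u k) i @[k --> \oo] --> tnth x i) ->
  (fun k => empirical (u k) : distr R) @ \oo --> (empirical x : distr R).
Proof.
move=> ux; apply: weak_cvg => f.
rewrite expect_empirical.
rewrite -[X in X --> _]/((fun k => expect f (empirical (u k))) @ \oo).
under eq_fun do rewrite expect_empirical.
apply: cvgMl_tmp; apply: cvg_big => [|i _]; first exact: add_continuous.
have [cf _] := projT2 f.
exact: (cvg_comp _ _ (ux i) (cf _)).
Qed.

Lemma measurable_error_event (R : realType) (E : distr R -> R) (n : nat)
    (theta Delta : R) : continuous E ->
  measurable [set x : n.+1.-tuple (measurableTypeR R) |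
    Delta < `|E (empirical x) - theta|].
Proof.
move=> cE.
apply: (measurable_superlevel _ _).2.
apply: measurableT_comp => //; apply: measurable_funB => //.
apply: seq_continuous_measurable => u x ux.
exact: (cvg_comp _ _ (empirical_cvg ux) (cE _)).
Qed.

(** * Lower bounds on the error probability *)

Lemma limn_esup_lt_near (R : realType) (u : nat -> \bar R) (a : R) :
  (limn_esup u < a%:E)%E ->
  exists2 b : R, b < a & \forall n \near \oo, (u n <= b%:E)%E.
Proof.
move=> /ereal_inf_lt[_ [V Voo <-]].
set s := ereal_sup _ => sa.
have [b ba sb] : exists2 b : R, b < a & (s <= b%:E)%E.
  case: s sa => [s sa|//|_]; first by exists s; rewrite ?lexx// -lte_fin.
  by exists (a - 1); rewrite ?leNye//; lra.
exists b => //; apply: filterS Voo => n Vn; apply: le_trans sb.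
by apply: ereal_sup_ubound; exists n.
Qed.

Section error_probability.
Context {R : realType} (E : distr R -> R) (theta Delta : R).
Hypothesis cE : continuous E.

Lemma error_prob_ge0 (P : distr R) n : 0 <= fine (error_prob E P theta Delta n).
Proof. by rewrite fine_ge0// measure_ge0. Qed.

Lemma error_prob_fineK (P : distr R) n :
  (fine (error_prob E P theta Delta n))%:E = error_prob E P theta Delta n.
Proof.
apply: fineK; apply: (fin_num_measure (iid P n.+1)).
exact: measurable_error_event.
Qed.

(** Continuity of [E] at [P] makes the laws with a large error a neighbourhood
    of [P], and neighbourhoods of [P] are typical. *)
Lemma error_prob_near1 (P : distr R) (e : R) : Delta < `|E P - theta| ->
  0 < e -> \forall n \near \oo, 1 - e <= fine (error_prob E P theta Delta n).
Proof.
move=> far e0.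
have typA : typical P [set P' : distr R | Delta < `|E P' - theta|].
  have cdist : (fun y : R => `|y - theta|) @ E P --> `|E P - theta|.
    by apply: cvg_norm; apply: cvgB; [exact: cvg_id|exact: cvg_cst].
  have EP_far : nbhs (E P) [set y : R | Delta < `|y - theta|].
    by apply: (cdist [set y | Delta < y]); exact: lt_nbhsr.
  by apply: typical_cvg; exact: cE EP_far.
apply: filterS (typA _ e0) => n [N [mN AN PN]].
pose A := [set x : n.+1.-tuple (measurableTypeR R) |
  Delta < `|E (empirical x) - theta|].
have mA : measurable A by exact: measurable_error_event.
have PC : (iid P n.+1 (~` A) <= e%:E)%E.
  apply: le_trans PN; apply: le_measure; rewrite ?inE//.
  exact: measurableC mA.
have := probability_setC (iid P n.+1) mA.
move: PC => /[swap] ->; rewrite -/(error_prob E P theta Delta n).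
by rewrite -error_prob_fineK -EFinB lee_fin; lra.
Qed.

Lemma error_prob_log_integral_bound (P Q : distr R) (r t : R) n :
  log_integral_bound P Q r -> 0 <= t ->
  t * fine (error_prob E P theta Delta n) <= n.+1%:R * r +
    ln (1 + (expR t - 1) * fine (error_prob E Q theta Delta n)).
Proof.
move=> PQr t0; apply: log_integral_bound_event => //.
- exact: iid_log_integral_bound.
- exact: measurable_error_event.
Qed.

(** With [K = 0] and [t = 1] the error probability [p] under [P] and [q] under
    [Q] satisfy [p <= ln (1 + (exp 1 - 1) q) <= exp 1 * q], so [q] stays away from 0 as
    [p] tends to 1. *)
Lemma error_prob_not_null (P Q : distr R) : Delta < `|E P - theta| ->
  log_integral_bound P Q 0 -> limn_esup (error_prob E Q theta Delta) <> 0%E.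
Proof.
move=> far PQ0 null.
have [b be nearb] : exists2 b : R, b < (expR 1)^-1 / 4 &
    \forall n \near \oo, (error_prob E Q theta Delta n <= b%:E)%E.
  apply: limn_esup_lt_near.
  by rewrite null lte_fin divr_gt0// invr_gt0 expR_gt0.
near \oo => n.
have := error_prob_log_integral_bound n PQ0 ler01.
have : 1 - 2^-1 <= fine (error_prob E P theta Delta n).
  by near: n; exact: error_prob_near1.
have : fine (error_prob E Q theta Delta n) <= b.
  by rewrite -lee_fin error_prob_fineK; near: n.
have := error_prob_ge0 Q n; rewrite mulr0 add0r mul1r.
set p := fine (error_prob E P _ _ _); set q := fine _ => q0 qb p_half pq.
have e1 : 1 <= expR 1 :> R by rewrite -expR0 ler_expR.
have eq0 : 0 <= (expR 1 - 1) * q by rewrite mulr_ge0// subr_ge0.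
have eq : expR 1 * q <= 4^-1.
  by rewrite mulrC -ler_pdivlMr ?expR_gt0// mulrC (le_trans qb)// ltW.
have p4 : p <= 4^-1.
  rewrite (le_trans pq)// (le_trans (le_ln1Dx (lt_le_trans (ltrN10 R) eq0)))//.
  by rewrite mulrBl mul1r (le_trans _ eq)// gerBl.
by move: (le_trans p_half p4); clear null; lra.
Unshelve. all: by end_near. Qed.

(** The lower bound of Sanov's theorem for the error event. If the error
    probability [q] under [Q] were at most [exp (- t)] with [t = (n + 1) c] and
    [c > r], then [(expR t - 1) * q <= 1], hence
    [c * p <= r + 1 / (n + 1)], while the error probability [p] under [P]
    tends to 1. *)
Lemma error_prob_decay_ge (P Q : distr R) (r : R) : Delta < `|E P - theta| ->
  0 < r -> log_integral_bound P Q r ->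
  ((- r)%:E <= limn_esup (fun n => (n.+1%:R^-1)%:E *
     lne (error_prob E Q theta Delta n)))%E.
Proof.
move=> far r0 PQr; rewrite leNgt; apply/negP => /limn_esup_lt_near[b br nearb].
pose c := - b; have rc : r < c by rewrite /c ltrNr.
have c0 : 0 < c by exact: lt_trans rc.
(* for this [e], the bound [c * (1 - e)] is the midpoint of [r] and [c] *)
have e0 : 0 < (c - r) / (2 * c) by rewrite divr_gt0 ?mulr_gt0// subr_gt0.
near \oo => n.
have n0 : 0 < n.+1%:R :> R by rewrite ltr0n.
have := error_prob_log_integral_bound n PQr (mulr_ge0 (ltW n0) (ltW c0)).
have : 1 - (c - r) / (2 * c) <= fine (error_prob E P theta Delta n).
  by near: n; exact: error_prob_near1.
have : fine (error_prob E Q theta Delta n) <= expR (- (n.+1%:R * c)).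
  have [->|q_neq0] := eqVneq (fine (error_prob E Q theta Delta n)) 0.
    exact: expR_ge0.
  have q_gt0 : 0 < fine (error_prob E Q theta Delta n).
    by rewrite lt_neqAle eq_sym q_neq0 error_prob_ge0.
  rewrite -ler_ln ?posrE ?expR_gt0// expRK -mulrN /c opprK -ler_pdivrMl//.
  by rewrite -lee_fin EFinM -lne_EFin// error_prob_fineK; near: n.
have := error_prob_ge0 Q n.
set p := fine (error_prob E P _ _ _); set q := fine _; set t := n.+1%:R * c.
move=> q0 qn pn tp.
have qt : (expR t - 1) * q <= 1.
  rewrite mulrBl mul1r (@le_trans _ _ (expR t * q)) ?gerBl//.
  by rewrite -(expRxMexpNx_1 t) ler_pM2l ?expR_gt0.
have et1 : 1 <= expR t by rewrite -expR0 ler_expR mulr_ge0// ltW.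
have eq0 : 0 <= (expR t - 1) * q by rewrite mulr_ge0// subr_ge0.
have lnq : ln (1 + (expR t - 1) * q) <= 1.
  by rewrite (le_trans _ qt)// le_ln1Dx// (lt_le_trans (ltrN10 R)).
have cp : (c + r) / 2 <= c * p.
  rewrite -[leLHS](_ : c * (1 - (c - r) / (2 * c)) = _) ?ler_pM2l//.
  by field; rewrite gt_eqF.
have nbig : 2 / (c - r) < n.+1%:R.
  rewrite (@le_lt_trans _ _ n%:R) ?ltr_nat//.
  by near: n; exact: nbhs_infty_ger.
move: nbig; rewrite ltr_pdivrMr ?subr_gt0// ltNge => /negP; apply.
have := ler_wpM2l (ltW n0) cp; rewrite mulrA.
move: tp lnq; rewrite /t; set L := ln _; set m : R := n.+1%:R.
by lra.
Unshelve. all: by end_near. Qed.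

End error_probability.

Lemma KL_le_log_integral_bound (R : realType) (P Q : distr R) (r : R) :
  (KL P Q <= r%:E)%E -> log_integral_bound P Q r.
Proof.
rewrite /KL; case: ifPn => [/asboolP PQ|_]; last by rewrite leye_eq.
exact: relative_entropy_log_integral_bound.
Qed.

Theorem theorem3p6 (R : realType) (g : symmetric_logconcave_density R)
  (E : distr R -> R) (E_regular : continuous E)
  (r alpha : R) (r_ge0 : 0 <= r) (alpha_ge0 : 0 <= alpha) :
  (Delta_wc g r alpha <= Delta_inf g E r alpha)%E.
Proof.
apply: le_ereal_inf_tmp => _ [Delta [Delta0 cov] <-].
apply: ge_ereal_sup => _ [P _ <-].
rewrite /chebyshev_radius; case: ifPn => [_|_]; first by rewrite lee_fin.
apply: ereal_inf_le.
exists (ereal_sup [set `|E P - s'|%:E | s' in dro_set g r alpha P]).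
  by exists (E P).
apply: ge_ereal_sup => _ [theta [Q [KLr TVa]] <-]; rewrite lee_fin.
have [exp_decay null_limit] := cov theta Q TVa.
have PQr := KL_le_log_integral_bound KLr.
rewrite leNgt; apply/negP => far.
move: r_ge0; rewrite le_eqVlt => /predU1P[r0|r0].
- rewrite -r0 in PQr null_limit.
  by apply: (error_prob_not_null E_regular far PQr); exact: null_limit.
- have := exp_decay r0.
  by rewrite ltNge (error_prob_decay_ge E_regular far r0 PQr).
Qed.
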